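(* Let $P(z)\in\mathbb{C}[z]$ be a homogeneous harmonic polynomial of degree $d\ge2$ written as $P(z)=\sum_{i=1}^kh_{\alpha_i}^d(z)$ with $\alpha_1,\dots,\alpha_k\in\mathbb{C}^n$ isotropic and $h_{\alpha_1}^d,\dots,h_{\alpha_k}^d$ linearly independent. Suppose the graph $\mathcal{G}(P)$ has $r\ge2$ connected components, and let $\{1,\dots,k\}=I_1\sqcup\cdots\sqcup I_r$ be the corresponding partition of its vertex set. Set $P_i(z):=\sum_{j\in I_i}h_{\alpha_j}^d(z)$ for $1\le i\le r$. Then: (a) $P$ is HN if and only if each $P_i$ is HN. (b) If $P$ is HN and the VC holds for each $P_i$ (i.e. for each $i$, $\Delta^mP_i^{m+1}=0$ for all sufficiently large $m$), then the VC holds for $P$ (i.e. $\Delta^mP^{m+1}=0$ for all sufficiently large $m$). Thus, to study homogeneous HN polynomials, or the VC for them, it is enough to consider the case when $\mathcal{G}(P)$ is connected.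
   Context: $z=(z_1,\dots,z_n)$; $\Delta=\sum_{i=1}^n\partial^2/\partial z_i^2$; harmonic means $\Delta P=0$. $\langle\cdot,\cdot\rangle$ is the standard $\mathbb{C}$-bilinear form $\langle u,v\rangle=\sum_iu_iv_i$ on $\mathbb{C}^n$; $\alpha$ is isotropic if $\langle\alpha,\alpha\rangle=0$; $h_\alpha(z):=\langle\alpha,z\rangle$. (Every homogeneous harmonic polynomial $P(z)$ of degree $d\ge2$ admits an expression $P(z)=\sum_{i=1}^kh_{\alpha_i}^d(z)$ with $\alpha_1,\dots,\alpha_k\in\mathbb{C}^n$ isotropic and $h_{\alpha_1}^d,\dots,h_{\alpha_k}^d$ linearly independent.) A polynomial is HN (Hessian nilpotent) if its Hessian matrix is nilpotent. VC stands for the vanishing conjecture. The graph $\mathcal{G}(P)$, relative to the fixed expression of $P$, has vertex set $\{1,\dots,k\}$, with vertices $i$ and $j$ connected by an edge if and only if $\langle\alpha_i,\alpha_j\rangle\neq0$. *)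

(* Defs.v *)
From HB Require Import structures.
From mathcomp Require Import all_boot all_order all_algebra.
From mathcomp Require Import reals.
From mathcomp Require Import complex.
From mathcomp Require Import mpoly.
Set Implicit Arguments.
Unset Strict Implicit.
Unset Printing Implicit Defensive.
Import GRing.Theory.
Local Open Scope ring_scope.

Section Defs.
Variables (C : fieldType) (n : nat).
Implicit Types (P : {mpoly C[n]}) (u v : 'rV[C]_n).

(* The standard bilinear form: no conjugation, even when C is the field of
   complex numbers. *)
Definition bform u v : C := \sum_(i < n) u 0 i * v 0 i.

Definition isotropic u : Prop := bform u u = 0.

Definition hform u : {mpoly C[n]} := \sum_(i < n) u 0 i *: 'X_i.

Definition laplacian P : {mpoly C[n]} := \sum_(i < n) P^`M(i)^`M(i).

Definition harmonic P : Prop := laplacian P = 0.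

Definition hessian P : 'M[{mpoly C[n]}]_n := \matrix_(i, j) P^`M(i)^`M(j).

Definition HN P : Prop := exists m : nat, hessian P ^+ m = 0.

Definition VC P : Prop :=
  exists N : nat, forall m : nat, (N <= m)%N ->
    iter m laplacian (P ^+ m.+1) = 0.

(* Linear independence of a family; the library's [free] is only available in
   finite-dimensional spaces. *)
Definition lin_indep (k : nat) (f : 'I_k -> {mpoly C[n]}) : Prop :=
  forall c : 'I_k -> C, \sum_(i < k) c i *: f i = 0 -> forall i, c i = 0.

Section Expression.
Variables (d k : nat) (alpha : 'I_k -> 'rV[C]_n).

Definition psum (A : {set 'I_k}) : {mpoly C[n]} :=
  \sum_(j in A) hform (alpha j) ^+ d.

Definition expression_of P : Prop :=
  [/\ forall i, isotropic (alpha i),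
      lin_indep (fun i => hform (alpha i) ^+ d)
    & P = \sum_(i < k) hform (alpha i) ^+ d].

(* No i != j conjunct: there are no loops, since bform (alpha i) (alpha i) = 0
   for isotropic alpha i. *)
Definition graph : rel 'I_k := [rel i j | bform (alpha i) (alpha j) != 0].

Definition components : {set {set 'I_k}} :=
  equivalence_partition (connect graph) [set: 'I_k].

Definition connected_graph : Prop := #|components| = 1%N.
End Expression.

End Defs.

(* Main.v *)
(* The Hessians of the P_i annihilate each other, because the isotropic vectors
   of different components are orthogonal; hence Hes(P)^m is the sum of the
   Hes(P_i)^m for m >= 1, which gives (a).  By the same orthogonality the
   Laplacian is a derivation on products F G with F built from one component
   and G from the others.  Expanding Delta^m (F + G)^(m+1), every mixed term
   Delta^m (F^a G^b) with a + b = m + 1 and a, b >= 1 vanishes as soon as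
   Delta^a F^a = 0 and Delta^b G^b = 0, and only Delta^m F^(m+1) and
   Delta^m G^(m+1) survive.

   It remains to see that Delta^m P^m = 0 for m >= 1 whenever P is HN (Zhao).
   Let Q(t) solve dQ/dt = <grad Q, grad Q> with Q(0) = P.  The derivation
   delta = d/dt - 2 <grad Q, grad .> satisfies delta H = 2 H^2 for H = Hes(Q),
   so the traces tau_p of H^p satisfy delta tau_p = 2 p tau_(p+1).  They vanish
   at t = 0, hence identically; in particular Q is harmonic.  Therefore
   Delta Q^(k+1) = (k+1) d(Q^k)/dt, which makes Delta^m P^(k+m) a multiple of
   the coefficient of t^m in Q^k, and k = 0 gives the claim.  Power series in t
   are replaced by polynomials, the equation for Q holding modulo t^M. *)
Require Import Defs.
From HB Require Import structures.
From mathcomp Require Import all_boot all_order all_algebra.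
From mathcomp Require Import reals.
From mathcomp Require Import complex.
From mathcomp Require Import mpoly.
From mathcomp Require Import ring zify.
Set Implicit Arguments.
Unset Strict Implicit.
Unset Printing Implicit Defensive.
Import GRing.Theory.
Local Open Scope ring_scope.

(** * Traces of nilpotent matrices *)

Lemma map_mx_expr (R S : comNzRingType) (phi : {rmorphism R -> S}) m
  (H : 'M[R]_m) p : map_mx phi (H ^+ p) = map_mx phi H ^+ p.
Proof.
elim: p => [|p IH]; first by rewrite !expr0 map_mx1.
by rewrite !exprS -!mulmxE map_mxM IH.
Qed.

Lemma mxtrace_map (R S : nzRingType) (phi : {additive R -> S}) m (H : 'M[R]_m) :
  \tr (map_mx phi H) = phi (\tr H).
Proof. by rewrite raddf_sum; apply: eq_bigr => i _; rewrite mxE. Qed.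

Lemma mulmx_exprC (R : pzSemiRingType) m n (A : 'M[R]_(m, n)) (B : 'M[R]_(n, m)) p :
  (B *m A) ^+ p.+1 = B *m (A *m B) ^+ p *m A.
Proof.
elim: p => [|p IH]; first by rewrite expr0 expr1 mulmx1.
by rewrite exprS IH (exprS (A *m B)) -!mulmxE !mulmxA.
Qed.

(* Rank factorization [A = L *m U] replaces A by the smaller nilpotent matrix
   [U *m L], which has the same trace. *)
Lemma mxtrace_nilpotent_field (F : fieldType) n (A : 'M[F]_n) m :
  A ^+ m = 0 -> \tr A = 0.
Proof.
move: m A; have [N le_nN] := ubnP n; elim: N n le_nN => // N IH n le_nN m A Am0.
case: n A le_nN Am0 => [|n] A le_nN Am0; first by rewrite /mxtrace big_ord0.
have lt_rank : (\rank A < n.+1)%N.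
  rewrite ltn_neqAle rank_leq_row andbT; apply/negP => Afull.
  have : A ^+ m \is a GRing.unit by rewrite unitrX // -row_free_unit.
  by rewrite Am0 unitr0.
rewrite -(mulmx_base A) mxtrace_mulC; apply: (IH _ _ m.+1).
  exact: leq_trans lt_rank le_nN.
by rewrite mulmx_exprC mulmx_base Am0 mulmx0 mul0mx.
Qed.

(** The fraction field of [D] reduces this to the case of a field; the Hessian has its entries in
    such a domain, a polynomial ring. *)
Lemma mxtrace_nilpotent (D : idomainType) n (A : 'M[D]_n) m :
  A ^+ m = 0 -> \tr A = 0.
Proof.
move=> Am0; apply/eqP; rewrite -tofrac_eq0 -mxtrace_map /=.
apply/eqP/(@mxtrace_nilpotent_field _ _ _ m).
by rewrite -map_mx_expr Am0 map_mx0.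
Qed.

(** * Derivations applied to matrix powers *)

Section Derivation.
Variables (B : comNzRingType) (delta : {additive B -> B}).
Hypothesis deltaM : forall a b, delta (a * b) = delta a * b + a * delta b.

Lemma derivation1 : delta 1 = 0.
Proof.
by apply: (addrI (delta 1)); rewrite addr0 -{3}(mulr1 1) deltaM mul1r mulr1.
Qed.

Lemma derivationX a m : delta (a ^+ m.+1) = a ^+ m * delta a *+ m.+1.
Proof.
elim: m => [|m IH]; first by rewrite expr1 expr0 mul1r.
by rewrite exprSr deltaM IH (exprSr a m); ring.
Qed.

Lemma derivation_mulmx m n q (X : 'M[B]_(m, n)) (Y : 'M[B]_(n, q)) :
  map_mx delta (X *m Y) = map_mx delta X *m Y + X *m map_mx delta Y.
Proof.
apply/matrixP => i j; rewrite !mxE raddf_sum -big_split /=.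
by apply: eq_bigr => l _; rewrite !mxE deltaM.
Qed.

(** By the Leibniz rule each factor [H] becomes [2 H^2] in turn, and powers of [H] commute. The
    multiple of [x] carries the truncation error, with [x] equal to ['X^M] later on; only
    divisibility by [x] matters, so [E'] stays implicit. *)
Lemma derivation_mx_expr n (H E : 'M[B]_n) x :
    map_mx delta H = (H *m H) *+ 2 + x *: E ->
  forall p, exists E', map_mx delta (H ^+ p) = H ^+ p.+1 *+ (2 * p) + x *: E'.
Proof.
move=> dH; elim=> [|p [E' IH]].
  exists 0; rewrite expr0 muln0 mulr0n scaler0 addr0.
  apply/matrixP => i j; rewrite !mxE.
  by case: eqP => _; rewrite ?raddf0 // derivation1.
exists (E *m H ^+ p + H *m E').
rewrite exprS -mulmxE derivation_mulmx dH IH mulmxDl mulmxDr.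
rewrite -scalemxAl -scalemxAr scalerDr addrACA; congr (_ + _).
rewrite !mulmxE mulrnAl mulrnAr -mulrA -!exprS -mulrnDr.
by congr (_ *+ _); lia.
Qed.

End Derivation.

(** * The truncated Hamilton-Jacobi flow of a Hessian nilpotent polynomial *)

Section HessianFlow.
Variables (C : numFieldType) (n : nat).
Local Notation A := {mpoly C[n]}.
Local Notation B := {poly A}.
Implicit Types (P : A) (Q f g : B).

Local Notation "f ^`P ( i )" := (map_poly (mderiv i) f)
  (at level 2, format "f ^`P ( i )").

Lemma mpoly_mulrn_eq0 P m : P *+ m.+1 = 0 -> P = 0.
Proof.
by rewrite -scaler_nat => /eqP; rewrite scaler_eq0 Num.Theory.pnatr_eq0 => /eqP.
Qed.

Lemma pderivM i f g : (f * g)^`P(i) = f^`P(i) * g + f * g^`P(i).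
Proof.
apply/polyP => l; rewrite coef_map /= coefD !coefM raddf_sum -big_split /=.
by apply: eq_bigr => j _; rewrite mderivM !coef_map.
Qed.

Lemma pderiv_comm i j f : f^`P(i)^`P(j) = f^`P(j)^`P(i).
Proof. by apply/polyP => l; rewrite !coef_map /= mderiv_comm. Qed.

Lemma pderiv_deriv i f : (f^`P(i))^`() = (f^`())^`P(i).
Proof. by apply/polyP => l; rewrite coef_deriv !coef_map /= coef_deriv raddfMn. Qed.

Lemma pderivXnM i M f : ('X^M * f)^`P(i) = 'X^M * f^`P(i).
Proof.
apply/polyP => l; rewrite coef_map /= !coefXnM.
by case: ifP => _; rewrite ?raddf0 ?coef_map.
Qed.

Lemma pderivX i f m : (f ^+ m.+1)^`P(i) = f ^+ m * f^`P(i) *+ m.+1.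
Proof. exact: (derivationX (pderivM i)). Qed.

(* [Q] is a solution modulo ['X^M] of the Hamilton-Jacobi equation
   [dQ/dt = <grad Q, grad Q>], the time [t] being the variable ['X]. *)
Definition flow M Q E : Prop :=
  Q^`() = \sum_k Q^`P(k) * Q^`P(k) + 'X^M * E.

Lemma flow_exists P M : exists Q E, Q`_0 = P /\ flow M Q E.
Proof.
rewrite /flow; elim: M => [|M [Q [E [Q0 QE]]]].
  exists P%:P, (- \sum_k (P%:P)^`P(k) * (P%:P)^`P(k)).
  by rewrite coefC derivC expr0 mul1r subrr.
(* The derivative of [c t^(M+1)] is the lowest term of the error ['X^M * E], so subtracting
   [c t^(M+1)] from [Q] removes that term. *)
pose c : A := M.+1%:R^-1 *: E`_0.
have cM : c%:P *+ M.+1 = (E`_0)%:P.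
  rewrite -polyCMn -scaler_nat scalerA mulfV ?scale1r //.
  by rewrite Num.Theory.pnatr_eq0.
have Esplit : E = (E`_0)%:P + 'X * drop_poly 1 E.
  apply/polyP => -[|l]; rewrite coefD coefC coefXM ?addr0 //=.
  by rewrite add0r coef_drop_poly addn1.
pose cd k := (mderiv k c)%:P : B.
(* The new error: the tail of [E], and a compensation for the change in [<grad Q, grad Q>]. *)
pose E' := drop_poly 1 E
   + \sum_k (Q^`P(k) * cd k *+ 2 - cd k * cd k * 'X^(M.+1)).
exists (Q - 'X^(M.+1) * c%:P), E'; split.
  by rewrite coefB coefXnM /= subr0.
have -> : \sum_k (Q - 'X^(M.+1) * c%:P)^`P(k) * (Q - 'X^(M.+1) * c%:P)^`P(k) =
    \sum_k Q^`P(k) * Q^`P(k)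
    - 'X^(M.+1) * \sum_k (Q^`P(k) * cd k *+ 2 - cd k * cd k * 'X^(M.+1)).
  rewrite mulr_sumr -sumrB; apply: eq_bigr => k _.
  by rewrite raddfB /= pderivXnM map_polyC /= -/(cd k); ring.
have XMc : ('X^M *+ M.+1) * c%:P = 'X^M * (E`_0)%:P.
  by rewrite -cM mulrnAl mulrnAr.
rewrite derivB derivM derivXn derivC QE /E' mulr0 addr0 {1}Esplit /= XMc.
by rewrite exprS; ring.
Qed.

(* The convective derivative [d/dt - 2 <grad Q, grad .>]: along the flow it
   turns the Hessian of [Q] into twice its square. *)
Definition convective Q f : B := f^`() - (\sum_k Q^`P(k) * f^`P(k)) *+ 2.

Fact convective_is_zmod_morphism Q : zmod_morphism (convective Q).
Proof.
move=> f g; rewrite /convective derivB.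
under eq_bigr do rewrite raddfB mulrBr.
by rewrite sumrB; ring.
Qed.

HB.instance Definition _ Q :=
  GRing.isZmodMorphism.Build B B (convective Q) (convective_is_zmod_morphism Q).

Lemma convectiveM Q f g :
  convective Q (f * g) = convective Q f * g + f * convective Q g.
Proof.
rewrite /convective derivM.
under eq_bigr do rewrite pderivM mulrDr mulrA mulrCA.
by rewrite big_split /= -mulr_suml -mulr_sumr; ring.
Qed.

Definition pderiv_hessian Q : 'M[B]_n := \matrix_(i, j) Q^`P(i)^`P(j).

Lemma convective_hessian M Q E : flow M Q E ->
  map_mx (convective Q) (pderiv_hessian Q) =
  (pderiv_hessian Q *m pderiv_hessian Q) *+ 2 + 'X^M *: pderiv_hessian E.
Proof.
move=> QE; apply/matrixP => i j; rewrite !mxE /convective !pderiv_deriv QE.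
have -> : (\sum_k Q^`P(k) * Q^`P(k) + 'X^M * E)^`P(i)^`P(j) =
    (\sum_k Q^`P(k) * Q^`P(i)^`P(j)^`P(k)) *+ 2 +
    (\sum_k pderiv_hessian Q i k * pderiv_hessian Q k j) *+ 2 +
    'X^M * E^`P(i)^`P(j).
  rewrite !raddfD /= !pderivXnM !raddf_sum /=; congr (_ + _).
  rewrite -!sumrMnl -big_split /=; apply: eq_bigr => k _.
  rewrite pderivM raddfD /= !pderivM !mxE (pderiv_comm j k Q^`P(i)).
  by rewrite (pderiv_comm i k Q); ring.
by ring.
Qed.

(** The transport term differentiates in [z] only, so it vanishes in [t] to the same order as [f];
    in degree [j] only [d/dt] is left. *)
Lemma coef_convective Q f j : (forall l, (l <= j)%N -> f`_l = 0) ->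
  (convective Q f)`_j = f`_j.+1 *+ j.+1.
Proof.
move=> f0; rewrite coefB coefMn coef_deriv coef_sum big1 ?mul0rn ?subr0 // => k _.
rewrite coefM big1 // => l _.
by rewrite [X in _ * X]coef_map /= f0 ?raddf0 ?mulr0 // leq_subr.
Qed.

(** Induction on [l] for all [p] at once: coefficient [l+1] of the trace of one power of [H] is
    governed by coefficient [l] for the next power. *)
Lemma trace_hessian_flow P M Q E : HN P -> flow M Q E -> Q`_0 = P ->
  forall l p, (l <= M)%N -> (\tr (pderiv_hessian Q ^+ p.+1))`_l = 0.
Proof.
move=> [N PN] QE Q0; pose H := pderiv_hessian Q.
(* At [t = 0] the matrix [H] becomes [hessian P], whose positive powers are nilpotent. *)
have H0 p : (\tr (H ^+ p.+1))`_0 = 0.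
  rewrite -horner_coef0 -/(horner_eval 0 _) -mxtrace_map map_mx_expr /=.
  apply: (@mxtrace_nilpotent _ _ _ N); rewrite -exprM mulnC exprM.
  suff -> : map_mx (horner_eval 0) H = hessian P by rewrite PN expr0n.
  apply/matrixP => i j; rewrite !mxE /horner_eval horner_coef0 !coef_map /=.
  by rewrite Q0 mderiv_comm.
move=> l; elim/ltn_ind: l => -[|l] IH p lM; first exact: H0.
have [E' dH] := derivation_mx_expr (convectiveM Q) (convective_hessian QE) p.+1.
apply: (@mpoly_mulrn_eq0 _ l); rewrite -(@coef_convective Q); last first.
  by move=> j jl; apply: IH => //; apply: leq_trans lM; apply: leqW.
rewrite -mxtrace_map dH mxtraceD mxtraceZ raddfMn /= coefD coefMn coefXnM lM.
by rewrite addr0 IH ?mul0rn // ltnW.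
Qed.
(** [Delta Q^(k+1)] is [k+1] times [Q^k Delta Q + k Q^(k-1) <grad Q, grad Q>]. Below degree [M] in
    [t], [Delta Q] vanishes as a trace, and the flow equation turns the second term into
    [d(Q^k)/dt]. *)
Lemma laplacian_expr_flow P M Q E k l :
    HN P -> flow M Q E -> Q`_0 = P -> (l < M)%N ->
  laplacian (Q ^+ k.+1)`_l = (Q ^+ k)`_l.+1 *+ (l.+1 * k.+1).
Proof.
move=> PN QE Q0 lM.
have tr0 j : (j <= l)%N -> (\tr (pderiv_hessian Q))`_j = 0.
  move=> jl; rewrite -[pderiv_hessian Q]expr1.
  by apply: (trace_hessian_flow PN QE Q0); apply: leq_trans jl (ltnW lM).
have -> : laplacian (Q ^+ k.+1)`_l = (\sum_i (Q ^+ k.+1)^`P(i)^`P(i))`_l.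
  by rewrite coef_sum; apply: eq_bigr => i _; rewrite !coef_map.
rewrite mulrnA -coef_deriv -coefMn.
(* At [k = 0] the truncated exponent [k.-1] is harmless, its term being multiplied by [k]. *)
suff -> : \sum_i (Q ^+ k.+1)^`P(i)^`P(i) =
    (Q ^+ k * \tr (pderiv_hessian Q) - 'X^M * (Q ^+ k.-1 * E *+ k)
     + (Q ^+ k)^`()) *+ k.+1.
  rewrite !coefMn !coefD coefN coefXnM lM subr0.
  by rewrite [X in X + _]coefM big1 ?add0r // => j _; rewrite tr0 ?mulr0 ?leq_subr.
rewrite /mxtrace mulr_sumr.
under eq_bigr do rewrite pderivX raddfMn /= pderivM.
rewrite sumrMnl big_split /= addrC -[in RHS]addrA; congr ((_ + _) *+ _).
  by apply: eq_bigr => i _; rewrite mxE.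
case: k => [|k].
  rewrite expr0 derivC !mulr0n mulr0 oppr0 add0r; apply: big1 => i _.
  by rewrite (derivation1 (pderivM i)) mul0r.
rewrite deriv_exp QE /=.
under eq_bigr do rewrite pderivX mulrnAl -mulrA.
by rewrite sumrMnl -mulr_sumr; ring.
Qed.

(* The flow computes the powers of the Laplacian: [Delta^m P^(k+m)] is a
   multiple of the coefficient of [t^m] in [Q^k]; take [k = 0]. *)
Lemma iter_laplacian_HN P m : HN P -> iter m.+1 (@laplacian C n) (P ^+ m.+1) = 0.
Proof.
move=> PN; have [Q [E [Q0 QE]]] := flow_exists P m.+1.
have key l k : (l <= m.+1)%N ->
    exists c, iter l (@laplacian C n) (P ^+ (k + l)) = (Q ^+ k)`_l *+ c.
  elim: l k => [|l IH] k lm.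
    exists 1%N; rewrite addn0 -Q0 -!horner_coef0 /=.
    by rewrite -[RHS]/(horner_eval 0 (Q ^+ k)) rmorphXn.
  have [c lapc] := IH k.+1 (ltnW lm).
  exists (l.+1 * k.+1 * c)%N; rewrite iterS -addSnnS lapc mulrnA.
  rewrite -(laplacian_expr_flow k PN QE Q0 lm) /laplacian -sumrMnl.
  by apply: eq_bigr => i _; rewrite !raddfMn.
by have [c ->] := key m.+1 0 (leqnn _); rewrite expr0 coefC mul0rn.
Qed.

End HessianFlow.

(** * Polynomials with mutually orthogonal gradients *)

(** A word in [x] and [y] that begins with [x] and contains [y] has a factor [x * y]. *)
Lemma mulr0_expr (R : pzRingType) (x y : R) m :
  x * y = 0 -> x * (x + y) ^+ m = x ^+ m.+1.
Proof.
move=> xy; elim: m => [|m IH]; first by rewrite mulr1.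
by rewrite exprSr mulrA IH mulrDr -exprSr (exprSr x m) -mulrA xy mulr0 addr0.
Qed.

Section OrthogonalGradients.
Variables (C : numFieldType) (n k : nat) (alpha : 'I_k -> 'rV[C]_n).
Local Notation A := {mpoly C[n]}.
Local Notation lap := (@laplacian C n).
Implicit Types (S T : {set 'I_k}) (F G X Y : A).

Fact laplacian_is_zmod_morphism : zmod_morphism lap.
Proof. by move=> X Y; rewrite -sumrB; apply: eq_bigr => i _; rewrite !raddfB. Qed.

HB.instance Definition _ :=
  GRing.isZmodMorphism.Build A A lap laplacian_is_zmod_morphism.

Lemma iter_laplacian_sum m (J : Type) (s : seq J) (F : J -> A) :
  iter m lap (\sum_(j <- s) F j) = \sum_(j <- s) iter m lap (F j).
Proof. by elim: m => //= m ->; rewrite raddf_sum. Qed.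

Lemma iter_laplacianD m X Y : iter m lap (X + Y) = iter m lap X + iter m lap Y.
Proof. by elim: m => //= m ->; rewrite raddfD. Qed.

Lemma iter_laplacianMn m X c : iter m lap (X *+ c) = iter m lap X *+ c.
Proof. by elim: m => //= m ->; rewrite raddfMn. Qed.

Lemma iter_laplacian0 m : iter m lap 0 = 0.
Proof. by elim: m => //= m ->; rewrite raddf0. Qed.

(* Membership in a subring stable under all partial derivatives, and which
   contains the forms [h_(alpha j)] for [j \in S]. *)
Definition gradient_in S X := exists g : 'I_k -> A,
  forall i, X^`M(i) = \sum_(j in S) alpha j 0 i *: g j.

Lemma gradient_in0 S : gradient_in S 0.
Proof.
exists (fun=> 0) => i; rewrite raddf0 big1 // => j _; exact: scaler0.
Qed.

Lemma gradient_in1 S : gradient_in S 1.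
Proof.
exists (fun=> 0) => i; rewrite mderivC big1 // => j _; exact: scaler0.
Qed.

Lemma gradient_inD S X Y :
  gradient_in S X -> gradient_in S Y -> gradient_in S (X + Y).
Proof.
move=> [g gX] [h hY]; exists (fun j => g j + h j) => i.
by rewrite mderivD gX hY -big_split; apply: eq_bigr => j _; rewrite scalerDr.
Qed.

Lemma gradient_in_sum S (J : Type) (s : seq J) (Q : pred J) (F : J -> A) :
  (forall j, Q j -> gradient_in S (F j)) -> gradient_in S (\sum_(j <- s | Q j) F j).
Proof.
move=> FS; apply: big_ind FS; [exact: gradient_in0 | exact: gradient_inD].
Qed.

Lemma gradient_inM S X Y :
  gradient_in S X -> gradient_in S Y -> gradient_in S (X * Y).
Proof.
move=> [g gX] [h hY]; exists (fun j => g j * Y + X * h j) => i.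
rewrite mderivM gX hY mulr_suml mulr_sumr -big_split; apply: eq_bigr => j _ /=.
by rewrite scalerDr scalerAl scalerAr.
Qed.

Lemma gradient_inX S X m : gradient_in S X -> gradient_in S (X ^+ m).
Proof.
move=> XS; elim: m => [|m IH]; first exact: gradient_in1.
by rewrite exprS; apply: gradient_inM.
Qed.

Lemma gradient_in_mderiv S X i : gradient_in S X -> gradient_in S X^`M(i).
Proof.
move=> [g gX]; exists (fun j => (g j)^`M(i)) => l.
rewrite mderiv_comm gX raddf_sum; apply: eq_bigr => j _.
by rewrite /= mderivZ.
Qed.

Lemma gradient_in_laplacian S X : gradient_in S X -> gradient_in S (laplacian X).
Proof.
by move=> XS; apply: gradient_in_sum => i _; do 2!apply: gradient_in_mderiv.
Qed.

Lemma mderiv_hform (u : 'rV[C]_n) i : (hform u)^`M(i) = (u 0 i)%:MP.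
Proof.
rewrite raddf_sum (bigD1 i) //= big1 ?addr0 => [|j ji];
  rewrite linearZ /= mderivX mnm1E.
  rewrite eqxx scale1r (_ : (U_(i) - U_(i))%MM = 0%MM) ?mpolyX0; last first.
    by apply/mnmP => l; rewrite mnmBE subnn mnm0E.
  by rewrite -mul_mpolyC mulr1.
by rewrite (negPf ji) scale0r scaler0.
Qed.

Lemma gradient_in_hform S j : j \in S -> gradient_in S (hform (alpha j)).
Proof.
move=> jS; exists (fun l => (l == j)%:R) => i.
rewrite (bigD1 j) //= eqxx big1 ?addr0 => [|l /andP[_ /negPf->]].
  by rewrite mderiv_hform -mul_mpolyC mulr1.
exact: scaler0.
Qed.

Lemma gradient_in_psum d S : gradient_in S (psum d alpha S).
Proof.
by apply: gradient_in_sum => j jS; apply: gradient_inX; apply: gradient_in_hform.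
Qed.

Definition orthogonal_sets S T :=
  forall i j, i \in S -> j \in T -> bform (alpha i) (alpha j) = 0.

Lemma bformC (u v : 'rV[C]_n) : bform u v = bform v u.
Proof. by apply: eq_bigr => i _; rewrite mulrC. Qed.

Lemma orthogonal_setsC S T : orthogonal_sets S T -> orthogonal_sets T S.
Proof. by move=> ST i j iT jS; rewrite bformC ST. Qed.

Section Pair.
Variables S T : {set 'I_k}.
Hypothesis ST : orthogonal_sets S T.

Lemma gradient_dot0 X Y : gradient_in S X -> gradient_in T Y ->
  \sum_i X^`M(i) * Y^`M(i) = 0.
Proof.
move=> [g gX] [h hY].
under eq_bigr => i _ do rewrite gX hY big_distrlr /=.
rewrite exchange_big big1 //= => j jS; rewrite exchange_big big1 //= => l lT.
under eq_bigr => i _ do rewrite -scalerAl -scalerAr scalerA.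
by rewrite -scaler_suml -/(bform _ _) ST // scale0r.
Qed.

Lemma laplacianM X Y : gradient_in S X -> gradient_in T Y ->
  laplacian (X * Y) = laplacian X * Y + X * laplacian Y.
Proof.
move=> XS YT; rewrite /laplacian mulr_suml mulr_sumr -big_split /=.
under eq_bigr => i _ do rewrite mderivM mderivD !mderivM addrACA.
rewrite (_ : \sum_i _ = \sum_i (X^`M(i)^`M(i) * Y + X * Y^`M(i)^`M(i)) +
    (\sum_i X^`M(i) * Y^`M(i)) *+ 2).
  by rewrite (gradient_dot0 XS YT) mul0rn addr0.
by rewrite -sumrMnl -big_split; apply: eq_bigr => i _ /=; ring.
Qed.

(** Each entry of the product pairs the gradients of a partial derivative of [X] and one of [Y], and
    these are still orthogonal. *)
Lemma hessian_mul0 X Y : gradient_in S X -> gradient_in T Y ->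
  hessian X *m hessian Y = 0.
Proof.
move=> XS YT; apply/matrixP => i j; rewrite !mxE.
rewrite -[RHS](@gradient_dot0 X^`M(i) Y^`M(j)); try exact: gradient_in_mderiv.
by apply: eq_bigr => l _; rewrite !mxE (mderiv_comm l j).
Qed.

(** A pigeonhole argument: [m] Laplacians are distributed over two factors, and [m >= a + b - 1]
    forces at least [a] onto [X] or [b] onto [Y]. *)
Lemma iter_laplacianM0 m X Y a b : gradient_in S X -> gradient_in T Y ->
    iter a lap X = 0 -> iter b lap Y = 0 -> (a + b <= m.+1)%N ->
  iter m lap (X * Y) = 0.
Proof.
elim: m X Y a b => [|m IH] X Y [|a] [|b] XS YT X0 Y0 abm;
  try by rewrite ?(X0 : X = 0) ?(Y0 : Y = 0) ?mul0r ?mulr0 iter_laplacian0.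
  by lia.
rewrite iterSr laplacianM // iter_laplacianD.
rewrite (IH _ Y a b.+1) ?(IH X _ a.+1 b) ?addr0 //;
  by [lia | rewrite -iterSr | apply: gradient_in_laplacian].
Qed.
Lemma HN_orthogonalD F G : gradient_in S F -> gradient_in T G ->
  HN (F + G) <-> HN F /\ HN G.
Proof.
move=> FS GT; have HFG := hessian_mul0 FS GT.
(* Hessians are symmetric, so transposition reverses the product. *)
have HGF : hessian G * hessian F = 0.
  rewrite -mulmxE -[LHS]trmxK trmx_mul.
  have tr_hessian X : (hessian X)^T = hessian X.
    by apply/matrixP => i j; rewrite !mxE mderiv_comm.
  by rewrite !tr_hessian HFG trmx0.
have HD : hessian (F + G) = hessian F + hessian G.
  by apply/matrixP => i j; rewrite !mxE !mderivD.
rewrite /HN HD; move: (hessian F) (hessian G) HFG HGF => X Y XY YX.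
have YXY m : Y * (X + Y) ^+ m = Y ^+ m.+1 by rewrite addrC mulr0_expr.
split=> [[m Hm]|[[m Xm] [l Yl]]].
  by split; exists m.+1; rewrite -?YXY -?(mulr0_expr m XY) Hm mulr0.
exists (m + l).+1; rewrite exprS mulrDl mulr0_expr // YXY -addnS exprD Xm mul0r.
by rewrite addnC addSnnS exprD Yl mul0r addr0.
Qed.

Lemma VC_orthogonalD F G : gradient_in S F -> gradient_in T G ->
  HN F -> HN G -> VC F -> VC G -> VC (F + G).
Proof.
move=> FS GT FN GN [N1 VF] [N2 VG]; exists (maxn N1 N2) => m.
rewrite geq_max => /andP[N1m N2m]; rewrite exprDn iter_laplacian_sum.
apply: big1 => -[i /= im] _; rewrite iter_laplacianMn.
(* The VC is used for the two pure powers only; mixed terms need just [HN]. *)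
have [->|i0] := posnP i; first by rewrite subn0 expr0 mulr1 VF ?mul0rn.
have [->|im'] := eqVneq i m.+1; first by rewrite subnn expr0 mul1r VG ?mul0rn.
have [a Da] : exists a, (m.+1 - i)%N = a.+1 by exists (m - i)%N; lia.
case: i i0 im im' Da => // b _ im im' Da.
rewrite Da (@iter_laplacianM0 _ _ _ a.+1 b.+1) ?mul0rn ?iter_laplacian_HN //.
- exact: gradient_inX.
- exact: gradient_inX.
- by lia.
Qed.

End Pair.
End OrthogonalGradients.

(** * Connected components of the graph *)

Section Components.
Variables (C : numFieldType) (n k : nat) (alpha : 'I_k -> 'rV[C]_n).

Lemma graph_sym : ssrbool.symmetric (graph alpha).
Proof. by move=> i j; rewrite /graph /= bformC. Qed.

Lemma connect_graph_equivalence : equivalence_rel (connect (graph alpha)).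
Proof.
have sym := sym_connect_sym graph_sym.
apply/equivalence_relP; split; first exact: connect0.
by apply: left_trans => //; exact: connect_trans.
Qed.

Lemma components_partition : partition (components alpha) [set: 'I_k].
Proof.
apply: equivalence_partitionP => x y z _ _ _.
exact: connect_graph_equivalence.
Qed.

Lemma mem_component (S : {set 'I_k}) i j :
  S \in components alpha -> i \in S -> (j \in S) = connect (graph alpha) i j.
Proof.
move=> SC iS; have /and3P[_ triv _] := components_partition.
rewrite -(def_pblock triv SC iS) pblock_equivalence_partition ?inE // => x y z _ _ _.
exact: connect_graph_equivalence.
Qed.

(** A nonzero [bform] would be an edge joining two different components. *)
Lemma orthogonal_components (S T : {set 'I_k}) :
  S \in components alpha -> T \in components alpha -> S != T ->
  orthogonal_sets alpha S T.
Proof.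
move=> SC TC ST i j iS jT; apply/eqP; apply: contraNT ST => ij.
have /and3P[_ triv _] := components_partition.
apply/eqP; rewrite -(def_pblock triv SC iS) -(def_pblock triv TC jT).
apply: (same_pblock triv); rewrite (def_pblock triv TC jT).
by rewrite (mem_component _ TC jT) connect1 // graph_sym.
Qed.

Lemma bigcup_components (r : nat) (I : 'I_r -> {set 'I_k}) :
  [set I i | i : 'I_r] = components alpha ->
  \bigcup_(i <- enum 'I_r) I i = [set: 'I_k].
Proof.
move=> IC; have /and3P[/eqP <- _ _] := components_partition.
by rewrite /cover -IC big_imset_idem /= ?big_enum //; exact: setUid.
Qed.

Lemma disjoint_components (S T : {set 'I_k}) :
  S \in components alpha -> T \in components alpha -> S != T -> [disjoint S & T].
Proof. by have /and3P[_ /trivIsetP triv _] := components_partition; exact: triv. Qed.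

Lemma bigcup_seqP (r : nat) (I : 'I_r -> {set 'I_k}) (s : seq 'I_r) x :
  reflect (exists2 i, i \in s & x \in I i) (x \in \bigcup_(i <- s) I i).
Proof. by rewrite bigcup_seq; apply: bigcupP. Qed.

(** * Nilpotency and the VC for unions of components *)

Section Sums.
Variables (d r : nat) (I : 'I_r -> {set 'I_k}).
Hypothesis I_inj : injective I.
Hypothesis I_components : [set I i | i : 'I_r] = components alpha.
Local Notation U s := (\bigcup_(i <- s) I i).

Let I_component i : I i \in components alpha.
Proof. by rewrite -I_components imset_f. Qed.

Lemma orthogonal_bigcup i s : i \notin s -> orthogonal_sets alpha (I i) (U s).
Proof.
move=> is_ x y xi /bigcup_seqP[j js yj]; apply: orthogonal_components xi yj => //.
by apply: contraNneq is_ => /I_inj ->.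
Qed.

Lemma psum_bigcup_cons i s : i \notin s ->
  psum d alpha (U (i :: s)) = psum d alpha (I i) + psum d alpha (U s).
Proof.
move=> is_; rewrite big_cons /psum.
rewrite (eq_bigl [predU I i & U s]) => [|x]; last by rewrite !inE.
rewrite bigU //=; apply/pred0P => x /=; apply/negP => /andP[xi /bigcup_seqP[j js xj]].
have ij : I i != I j by apply: contraNneq is_ => /I_inj ->.
have := disjoint_components (I_component i) (I_component j) ij.
by move/disjointFr => /(_ _ xi); rewrite xj.
Qed.

(** Indexing the union by a list lets the induction detach one component, orthogonal to the union of
    the others. *)
Lemma HN_bigcup s : uniq s ->
  HN (psum d alpha (U s)) <-> forall i, i \in s -> HN (psum d alpha (I i)).
Proof.
elim: s => [|i s IH] /= => [_|/andP[is_ us]].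
  split=> [_ i|_]; first by rewrite in_nil.
  rewrite big_nil /psum big_set0; exists 1%N.
  by apply/matrixP => a b; rewrite expr1 !mxE !raddf0.
rewrite (psum_bigcup_cons is_).
have HND := HN_orthogonalD (orthogonal_bigcup is_)
  (gradient_in_psum alpha d _) (gradient_in_psum alpha d _).
split=> [/HND[Hi /(IH us) Hs] j|H].
  by rewrite inE => /predU1P[->|/Hs].
apply/HND; split; first by apply: H; rewrite mem_head.
by apply/(IH us) => j js; apply: H; rewrite inE js orbT.
Qed.

Lemma VC_bigcup s : uniq s -> (forall i, HN (psum d alpha (I i))) ->
  (forall i, VC (psum d alpha (I i))) -> VC (psum d alpha (U s)).
Proof.
move=> us HNI VCI; elim: s us => [|i s IH] /= => [_|/andP[is_ us]].
  rewrite big_nil /psum big_set0; exists 0%N => m _.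
  by rewrite expr0n iter_laplacian0.
rewrite (psum_bigcup_cons is_).
apply: (VC_orthogonalD (orthogonal_bigcup is_)); try exact: gradient_in_psum.
- exact: HNI.
- by apply/HN_bigcup.
- exact: VCI.
- exact: IH.
Qed.

Lemma psum_setT_bigcup :
  psum d alpha (U (enum 'I_r)) = \sum_(i < k) hform (alpha i) ^+ d.
Proof. by rewrite bigcup_components //; apply: eq_bigl => i; rewrite inE. Qed.

End Sums.

(** * Each component as an instance with connected graph *)

Lemma hform_homog (u : 'rV[C]_n) : hform u \is 1.-homog.
Proof.
by apply: rpred_sum => i _; apply: dhomogZ; rewrite dhomogX /= mdeg1.
Qed.

Lemma psum_homog d S : psum d alpha S \is d.-homog.
Proof.
apply: rpred_sum => j _; have := dhomogMn d (hform_homog (alpha j)).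
by rewrite mul1n.
Qed.

(** The Laplacian of a power of [hform u] is a multiple of [bform u u]. *)
Lemma psum_harmonic d S : (forall i, isotropic (alpha i)) -> harmonic (psum d alpha S).
Proof.
move=> iso; rewrite /harmonic raddf_sum big1 // => j _ /=.
have grad i e : (hform (alpha j) ^+ e)^`M(i) =
    (alpha j 0 i)%:MP * hform (alpha j) ^+ e.-1 *+ e.
  case: e => [|e]; first by rewrite mderivC.
  by rewrite (derivationX (mderivM i)) /= mderiv_hform mulrC.
rewrite /laplacian; under eq_bigr => i _ do
  rewrite grad mderivMn mderiv_mulC grad mulrnAr mulrA -mpolyCM.
rewrite sumrMnl sumrMnl -mulr_suml -raddf_sum /=.
by rewrite -/(bform (alpha j) (alpha j)) iso mul0r !mul0rn.
Qed.

Lemma expression_of_subset d P (S : {set 'I_k}) : expression_of d alpha P ->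
  expression_of d (fun x : 'I_#|S| => alpha (enum_val x)) (psum d alpha S).
Proof.
case=> iso indep _; split=> [i|c sum0 i|]; first exact: iso.
  (* Extension of [c] by zero: the fibre of [enum_val] over [j] is a single index if [j] is in [S],
     and empty otherwise. *)
  pose c' j := \sum_(x | enum_val x == j) c x.
  have -> : c i = c' (enum_val i).
    by rewrite /c' (big_pred1 i) // => x; rewrite /= (inj_eq enum_val_inj).
  apply: (indep c'); rewrite -[RHS]sum0.
  under eq_bigr => j _ do rewrite scaler_suml big_mkcond.
  rewrite exchange_big; apply: eq_bigr => x _ /=.
  rewrite (bigD1 (enum_val x)) //= eqxx big1 ?addr0 // => j jx.
  by rewrite eq_sym (negPf jx).
by rewrite /psum big_enum_val.
Qed.

(** A path that starts in a component never leaves it, so it lifts to the induced subgraph. *)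
Lemma component_connected (S : {set 'I_k}) : S \in components alpha ->
  connected_graph (fun x : 'I_#|S| => alpha (enum_val x)).
Proof.
move=> SC; set beta := fun x => _.
have lift p x : path (graph alpha) (enum_val x) p ->
    exists2 y : 'I_#|S|, enum_val y = last (enum_val x) p & connect (graph beta) x y.
  elim: p x => [|z p IH] x /=; first by exists x.
  case/andP=> xz zp; have xS := enum_valP x.
  have zS : z \in S by rewrite (mem_component _ SC xS) connect1.
  rewrite -(enum_rankK_in xS zS) in xz zp *.
  have [y <- wy] := IH _ zp; exists y => //.
  by apply: connect_trans wy; apply: connect1.
have conn x y : connect (graph beta) x y.
  have /connectP[p xp yE] : connect (graph alpha) (enum_val x) (enum_val y).
    by rewrite -(mem_component _ SC) ?enum_valP.
  have [w wE xw] := lift p x xp.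
  by rewrite (_ : y = w) //; apply: enum_val_inj; rewrite yE wE.
(* An empty graph would have no component rather than one. *)
have /set0Pn[x0 x0S] : S != set0.
  by have /and3P[_ _] := components_partition; apply: contraNneq => <-.
apply/eqP/cards1P; exists [set: 'I_#|S|]; apply/setP => T; rewrite !inE.
apply/imsetP/eqP => [[x _ ->]|->].
  by apply/setP => y; rewrite !inE conn.
exists (enum_rank_in x0S x0) => //.
by apply/setP => y; rewrite !inE conn.
Qed.

End Components.

(** The last two clauses make the closing reduction to connected graphs precise. *)
Theorem corollary8p5 (R : realType) (n d k r : nat)
  (P : {mpoly R[i][n]}) (alpha : 'I_k -> 'rV[R[i]]_n)
  (I : 'I_r -> {set 'I_k})
  (hd : (2 <= d)%N)
  (hhomog : P \is d.-homog)
  (hharm : harmonic P)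
  (hexpr : expression_of d alpha P)
  (hr : (2 <= r)%N)
  (hIinj : injective I)
  (hIcomp : [set I i | i : 'I_r] = components alpha) :
  [/\ HN P <-> (forall i : 'I_r, HN (psum d alpha (I i))),
      HN P -> (forall i : 'I_r, VC (psum d alpha (I i))) -> VC P,
      forall i : 'I_r,
        [/\ psum d alpha (I i) \is d.-homog,
            harmonic (psum d alpha (I i))
          & exists (k' : nat) (beta : 'I_k' -> 'rV[R[i]]_n),
              expression_of d beta (psum d alpha (I i)) /\
              connected_graph beta]
    & (forall (Q : {mpoly R[i][n]}) (k' : nat) (beta : 'I_k' -> 'rV[R[i]]_n),
         Q \is d.-homog -> harmonic Q -> expression_of d beta Q ->
         connected_graph beta -> HN Q -> VC Q) ->
      HN P -> VC P].
Proof.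
have [iso indep PE] := hexpr.
have HNP : HN P <-> forall i : 'I_r, HN (psum d alpha (I i)).
  rewrite PE -(psum_setT_bigcup d hIcomp) (HN_bigcup d hIinj hIcomp (enum_uniq _)).
  by split=> H i *; apply: H; rewrite ?mem_enum.
have VCP : HN P -> (forall i : 'I_r, VC (psum d alpha (I i))) -> VC P.
  move=> /HNP HNI VCI; rewrite PE -(psum_setT_bigcup d hIcomp).
  exact: (VC_bigcup hIinj hIcomp (enum_uniq _)).
have Iexpr i : exists (k' : nat) (beta : 'I_k' -> 'rV[R[i]]_n),
    expression_of d beta (psum d alpha (I i)) /\ connected_graph beta.
  exists #|I i|, (fun x => alpha (enum_val x)); split.
    exact: expression_of_subset hexpr.
  by apply: component_connected; rewrite -hIcomp imset_f.
split; [exact: HNP | exact: VCP | move=> i | move=> VCconn PN].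
  by split; [exact: psum_homog | exact: psum_harmonic | exact: Iexpr].
apply: (VCP PN) => i; have [k' [beta [exprb connb]]] := Iexpr i.
apply: (VCconn _ k' beta (psum_homog _ _ _) _ exprb connb).
  exact: psum_harmonic.
by move/HNP: PN; apply.
Qed.
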